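(* Let $C,A_1,\dots,A_m$ be real symmetric $s\times s$ matrices and $b\in\mathbb{R}^m$. Consider the semidefinite program: minimize $\langle C,X\rangle$ subject to $\langle A_i,X\rangle=b_i$ for $i=1,\dots,m$, $X\in S_+^s$, with optimal value $\hat f_p$, and its dual: maximize $b^Ty$ subject to $C-\sum_{i=1}^my_iA_i\in S_+^s$, $y\in\mathbb{R}^m$, with optimal value $\hat f_d$. Let $\overline{x}$ be a nonnegative real number and assume that (i) either the primal problem is infeasible, or (ii) for every $\varepsilon>0$ there exists a primal feasible solution $X(\varepsilon)$ with $X(\varepsilon)\le\overline{x}\cdot I$ and $\langle C,X(\varepsilon)\rangle-\hat f_p\le\varepsilon$, where $I$ is the identity matrix. Let $\tilde y\in\mathbb{R}^m$ and $$D=C-\sum_{i=1}^m\tilde y_iA_i.$$ Suppose that the real number $\underline{d}^-$ satisfies $\underline{d}^-\le\lambda_{\min}(D)$ and $\underline{d}^-\le0$, and that $D$ has at most $l$ negative eigenvalues. Then: (a) The primal optimal value is bounded from below by $$\hat f_p\ \ge\ b^T\tilde y+l\cdot\underline{d}^-\cdot\overline{x}=:\underline{f}_p.$$ (b) If $\underline{d}^-=0$, then $\tilde y$ is dual feasible and $\hat f_d\ge\underline{f}_p=b^T\tilde y$; if moreover $\tilde y$ is dual optimal, then $\hat f_d=\underline{f}_p$.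
   Context: $S_+^s$ is the cone of real symmetric positive semidefinite $s\times s$ matrices; $\langle X,Y\rangle=\mathrm{trace}(X^TY)$; for symmetric matrices $X\le Y$ means $Y-X\in S_+^s$. Eigenvalues are counted with multiplicity and $\lambda_{\min}$ is the smallest eigenvalue. $\hat f_p$ is the infimum of the primal objective ($+\infty$ if infeasible); $\hat f_d$ is the supremum of the dual objective ($-\infty$ if infeasible). *)

(* Defs.v *)
From HB Require Import structures.
From mathcomp Require Import all_boot all_order all_algebra.
From mathcomp Require Import polyrcf.
From mathcomp Require Import all_classical all_reals ereal.

Set Implicit Arguments.
Unset Strict Implicit.
Unset Printing Implicit Defensive.

Import Order.TTheory GRing.Theory Num.Theory.

Local Open Scope classical_set_scope.
Local Open Scope ring_scope.

Section SymmetricMatrices.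
Variables (R : realType) (s : nat).
Implicit Types X Y : 'M[R]_s.

Definition mxinner X Y : R := \tr (X^T *m Y).

Definition psdmx X : Prop :=
  X \is symmetricmx /\ forall v : 'cV[R]_s, 0 <= (v^T *m X *m v) 0 0.

Definition lemx X Y : Prop := psdmx (Y - X).

(* The real eigenvalues of X in nondecreasing order, each one repeated
   according to its multiplicity as a root of the characteristic polynomial.
   For symmetric X these are all the eigenvalues, and algebraic and geometric
   multiplicities agree. *)
Definition eigenvalues X : seq R :=
  flatten [seq nseq (mup a (char_poly X)) a | a <- rootsR (char_poly X)].

(* The default value 0 of [head] is only reached by a symmetric X if s = 0. *)
Definition lambda_min X : R := head 0 (eigenvalues X).

Definition nb_neg_eigenvalues X : nat := count (fun a => a < 0) (eigenvalues X).

Lemma char_poly_neq0 X : char_poly X != 0.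
Proof. exact: monic_neq0 (char_poly_monic X). Qed.

Lemma mem_rootsR_char_poly X a :
  (a \in rootsR (char_poly X)) = root (char_poly X) a.
Proof. by rewrite -(roots_on_rootsR (char_poly_neq0 X)). Qed.

Lemma mup_char_poly_gt0 X a :
  (0 < mup a (char_poly X))%N = root (char_poly X) a.
Proof. by rewrite -XsubC_dvd ?char_poly_neq0// dvdp_XsubCl. Qed.

Lemma mem_eigenvalues X a : (a \in eigenvalues X) = eigenvalue X a.
Proof.
rewrite eigenvalue_root_char; apply/flatten_mapP/idP => [[c]|ra].
  by rewrite mem_rootsR_char_poly => rc; rewrite mem_nseq => /andP[_ /eqP->].
by exists a; rewrite ?mem_rootsR_char_poly// mem_nseq eqxx mup_char_poly_gt0 ra.
Qed.

Lemma count_eigenvalues X a :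
  count_mem a (eigenvalues X) = mup a (char_poly X).
Proof.
rewrite /eigenvalues count_flatten -map_comp sumnE big_map.
under eq_bigr do rewrite /= count_nseq /=.
have [ra|/negbTE nra] := boolP (root (char_poly X) a); last first.
  rewrite big1_seq => [|c /andP[_]]; first by rewrite mupNroot ?nra.
  rewrite mem_rootsR_char_poly; case: eqVneq => [->|_ _]; last by rewrite mul0n.
  by rewrite nra.
rewrite (bigD1_seq a) ?mem_rootsR_char_poly ?uniq_roots//= eqxx mul1n.
by rewrite big1 ?addn0// => c /negbTE->.
Qed.

Lemma sorted_eigenvalues X : sorted <=%R (eigenvalues X).
Proof.
rewrite /eigenvalues; have := sorted_roots _ _ (char_poly X).
move=> /(_ (- cauchy_bound (char_poly X)) (cauchy_bound (char_poly X))).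
rewrite -/(rootsR _); elim: (rootsR _) => //= c r IH.
rewrite lt_path_sortedE => /andP[cr /IH sr].
elim: (mup c _) => //= k IHk; rewrite le_path_sortedE IHk andbT.
rewrite all_cat all_nseq lexx orbT /=; apply/allP => z /flatten_mapP[y yr].
by rewrite mem_nseq => /andP[_ /eqP->]; rewrite ltW// (allP cr).
Qed.

Lemma lambda_min_le X a : eigenvalue X a -> lambda_min X <= a.
Proof.
rewrite -mem_eigenvalues /lambda_min; have := sorted_eigenvalues X.
case: eigenvalues => //= c r; rewrite le_path_sortedE => /andP[cr _].
by rewrite inE => /predU1P[->//|/(allP cr)].
Qed.

Lemma eigenvalue_lambda_min X a : eigenvalue X a -> eigenvalue X (lambda_min X).
Proof.
rewrite -!mem_eigenvalues /lambda_min.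
by case: eigenvalues => //= c r _; rewrite inE eqxx.
Qed.

End SymmetricMatrices.

Section SemidefiniteProgram.
Variables (R : realType) (s m : nat).
Variables (C : 'M[R]_s) (A : 'I_m -> 'M[R]_s) (b : 'cV[R]_m).

Definition primal_feasible (X : 'M[R]_s) : Prop :=
  psdmx X /\ forall i, mxinner (A i) X = b i 0.

Definition dual_slack (y : 'cV[R]_m) : 'M[R]_s := C - \sum_i y i 0 *: A i.

Definition dual_feasible (y : 'cV[R]_m) : Prop := psdmx (dual_slack y).

Definition dual_objective (y : 'cV[R]_m) : R := (b^T *m y) 0 0.

Definition dual_optimal (y : 'cV[R]_m) : Prop :=
  dual_feasible y /\
  forall z, dual_feasible z -> dual_objective z <= dual_objective y.

(* [ereal_inf set0 = +oo] and [ereal_sup set0 = -oo] give the conventions for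
   infeasible problems. *)
Definition primal_value : \bar R :=
  ereal_inf [set (mxinner C X)%:E | X in [set X | primal_feasible X]].

Definition dual_value : \bar R :=
  ereal_sup [set (dual_objective y)%:E | y in [set y | dual_feasible y]].

End SemidefiniteProgram.

(* Main.v *)
Require Import Defs.
From mathcomp Require Import all_boot all_order all_algebra.
From mathcomp Require Import all_classical all_reals ereal.
From mathcomp Require Import complex.
Set Implicit Arguments.
Unset Strict Implicit.
Unset Printing Implicit Defensive.

Import Order.TTheory GRing.Theory Num.Theory.
Local Open Scope ring_scope.

(** Weak duality with error control. For a primal feasible X the identity
    <C, X> = b^T y + <D, X> holds, where D is the dual slack at y, so a lower
    bound on <C, X> amounts to one on <D, X>. Diagonalizing D turns <D, X> into
    a sum of r_i w_i, where the r_i are the eigenvalues of D and w_i is a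
    diagonal coefficient of X in the eigenbasis; 0 <= X <= xbar I forces
    0 <= w_i <= xbar ([spectral_weights]). Nonnegative eigenvalues contribute
    nonnegatively, and each of the at most l negative ones contributes at least
    dminus * xbar, whence <D, X> >= l * dminus * xbar
    ([mxinner_ge_neg_eigenvalues]). This bounds only those feasible X that lie
    below xbar I, but such X come arbitrarily close to the primal value
    ([ge_primal_value]).

    When dminus = 0 all eigenvalues of D are nonnegative, so D is positive
    semidefinite ([psdmx_lambda_min]): y is dual feasible, and its objective
    value is at most the dual value, with equality when y is optimal.

    The real spectral decomposition is read off from the complex one. If P is
    unitary and D = P^* diag(r) P with D and r real, taking real parts with
    P = a + i b gives D = a^T diag(r) a + b^T diag(r) b and a a^T + b b^T = 1
    ([real_symmetric_spectral]). This pair (a, b) serves as well as a real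
    orthogonal matrix would: w_i is the i-th diagonal coefficient of
    a X a^T + b X b^T, which is monotone in X and maps I to I. *)

(** * Symmetric matrices and characteristic polynomials *)

Lemma symmetricmxP (K : fieldType) (n : nat) (M : 'M[K]_n) :
  reflect (M^T = M) (M \is symmetricmx).
Proof.
by rewrite is_hermitianmxE expr0 scale1r map_mx_id// eq_sym; apply: eqP.
Qed.

Lemma char_poly_similar (K : comUnitRingType) (n : nat) (P B : 'M[K]_n) :
  P \in unitmx -> char_poly (invmx P *m B *m P) = char_poly B.
Proof.
move=> uP; rewrite /char_poly.
have -> : char_poly_mx (invmx P *m B *m P) =
    map_mx polyC (invmx P) *m char_poly_mx B *m map_mx polyC P.
  rewrite /char_poly_mx mulmxBr mulmxBl scalar_mxC -[_%:M *m _ *m _]mulmxA -!map_mxM.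
  by rewrite mulVmx// map_mx1 mulmx1.
rewrite !det_mulmx mulrAC -det_mulmx -map_mxM mulVmx//.
by rewrite map_mx1 det1 mul1r.
Qed.

Lemma mup_prod_XsubC (K : fieldType) (x : K) (cs : seq K) :
  mup x (\prod_(c <- cs) ('X - c%:P)) = count_mem x cs.
Proof.
elim: cs => [|c cs IH]; first by rewrite big_nil mupNroot// root1.
rewrite big_cons mupM ?polyXsubC_eq0 ?monic_neq0 ?monic_prod_XsubC//=.
by rewrite IH -[_ - _]expr1 mup_XsubCX; case: eqVneq.
Qed.

(** * Real spectral decomposition *)

Section ComplexParts.
Variable R : rcfType.
Local Notation Re := (map_mx (@complex.Re R)).
Local Notation Im := (map_mx (@complex.Im R)).

Lemma map_mx_ReM m n p (A : 'M[R[i]]_(m, n)) (B : 'M[R[i]]_(n, p)) :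
  Re (A *m B) = Re A *m Re B - Im A *m Im B.
Proof.
apply/matrixP => i j; rewrite !mxE -sumrB.
rewrite (big_morph _ (id1 := 0) (op1 := +%R))//; last by case=> ? ? [].
by apply: eq_bigr => k _; rewrite !mxE; case: (A i k) (B k j) => ? ? [].
Qed.

Lemma map_mx_ImM m n p (A : 'M[R[i]]_(m, n)) (B : 'M[R[i]]_(n, p)) :
  Im (A *m B) = Re A *m Im B + Im A *m Re B.
Proof.
apply/matrixP => i j; rewrite !mxE -big_split/=.
rewrite (big_morph _ (id1 := 0) (op1 := +%R))//; last by case=> ? ? [].
by apply: eq_bigr => k _; rewrite !mxE; case: (A i k) (B k j) => ? ? [].
Qed.

(** The matrices a and b are the real and imaginary parts of a unitary matrix
    that diagonalizes D over the complex numbers; the rows of a and b need not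
    be orthonormal separately. *)
Lemma real_symmetric_spectral (n : nat) (D : 'M[R]_n) : D \is symmetricmx ->
  exists a b : 'M[R]_n, exists r : 'rV[R]_n,
  [/\ a *m a^T + b *m b^T = 1%:M,
      D = a^T *m diag_mx r *m a + b^T *m diag_mx r *m b &
      char_poly D = \prod_i ('X - (r 0 i)%:P)].
Proof.
move=> symD; set toC := complex.real_complex R.
pose DC := map_mx toC D.
have hermD : DC \is hermsymmx.
  apply: realsym_hermsym.
    by apply/symmetricmxP; rewrite map_trmx; have /symmetricmxP-> := symD.
  by apply/mxOverP => i j; rewrite !mxE complex.complex_real.
pose P := spectralmx DC; pose d := spectral_diag DC.
have uP : P \is unitarymx by exact: spectral_unitarymx.
pose r := Re d.
have dE : d = map_mx toC r.
  apply/matrixP => i j; rewrite !mxE; apply/esym/complex.RRe_real.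
  by have /mxOverP := hermitian_spectral_diag_real hermD; apply.
have DE : DC = invmx P *m map_mx toC (diag_mx r) *m P.
  rewrite map_diag_mx -dE; apply/orthomx_spectralP.
  exact: hermitian_normalmx.
(* The imaginary part of the adjoint is minus a transpose, hence the plus signs
   in the two real identities obtained below. *)
have ReP : Re (map_mx Num.conj P^T) = (Re P)^T.
  by apply/matrixP => i j; rewrite !mxE; case: (P j i).
have ImP : Im (map_mx Num.conj P^T) = - (Im P)^T.
  by apply/matrixP => i j; rewrite !mxE; case: (P j i).
have ReC k l (A : 'M[R]_(k, l)) : Re (map_mx toC A) = A.
  by apply/matrixP => i j; rewrite !mxE.
have ImC k l (A : 'M[R]_(k, l)) : Im (map_mx toC A) = 0.
  by apply/matrixP => i j; rewrite !mxE.
exists (Re P), (Im P), r; split.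
- have /unitarymxP/(congr1 Re) := uP.
  rewrite map_mx_ReM ReP ImP mulmxN opprK => ->.
  by rewrite -(map_mx1 toC) ReC.
- have /(congr1 Re) := DE; rewrite invmx_unitary// ReC.
  rewrite !map_mx_ReM map_mx_ImM ReP ImP ReC ImC !mulmx0 subr0 add0r.
  by rewrite !mulNmx opprK.
apply: (map_poly_inj toC).
rewrite map_char_poly -/DC DE char_poly_similar ?unitarymx_unit//.
rewrite -map_char_poly char_poly_trig ?diag_mx_is_trig//.
by congr map_poly; apply: eq_bigr => i _; rewrite !mxE eqxx.
Qed.
End ComplexParts.

(** * Trace products with a symmetric matrix *)

Section SpectralWeights.
Variables (R : realType) (s : nat).
Implicit Types D X : 'M[R]_s.

Lemma psdmx_diag_congr (a : 'M[R]_s) X i :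
  psdmx X -> 0 <= (a *m X *m a^T) i i.
Proof.
case=> _ /(_ (row i a)^T); rewrite trmxK -row_mul.
by congr (0 <= _); rewrite [LHS]mxE [RHS]mxE; apply: eq_bigr => j _;
   rewrite !mxE.
Qed.

(** Here [w X i] is the i-th diagonal coefficient of a X a^T + b X b^T, with a
    and b as in [real_symmetric_spectral]: by cyclicity of the trace, <D, X> is
    the trace of diag(r) (a X a^T + b X b^T). The upper bound on the weights is
    their nonnegativity at t I - X, since a a^T + b b^T = 1. *)
Lemma spectral_weights D : D \is symmetricmx ->
  exists (r : 'I_s -> R) (w : 'M[R]_s -> 'I_s -> R),
  [/\ perm_eq (eigenvalues D) [seq r i | i <- enum 'I_s],
      forall X, mxinner D X = \sum_i r i * w X i,
      forall X i, psdmx X -> 0 <= w X i &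
      forall X t i, lemx X (t *: 1%:M) -> w X i <= t].
Proof.
move=> symD; have [a [b [r [ab1 DE charD]]]] := real_symmetric_spectral symD.
pose w X := a *m X *m a^T + b *m X *m b^T.
have w_ge0 X i : psdmx X -> 0 <= w X i i.
  by move=> psdX; rewrite mxE addr_ge0// psdmx_diag_congr.
exists (r 0), (fun X i => w X i i); split=> // [|X|X t i].
- apply/allP => x _ /=; rewrite count_eigenvalues charD -mup_prod_XsubC.
  by rewrite big_map big_enum.
- have /symmetricmxP DT := symD.
  rewrite /mxinner DT DE mulmxDl mxtraceD -!mulmxA.
  rewrite mxtrace_mulC [X in _ + X]mxtrace_mulC -!mulmxA -mxtraceD -mulmxDr.
  apply: eq_bigr => i _; rewrite mul_diag_mx mxE; congr (_ * _).
  by rewrite /w -!mulmxA.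
- move=> /w_ge0-/(_ i).
  rewrite /w !mulmxBr !mulmxBl addrACA -opprD -!scalemxAr -!scalemxAl !mulmx1.
  by rewrite -scalerDr ab1 !mxE eqxx mulr1 subr_ge0.
Qed.

(** On a negative eigenvalue r_i >= d the weight lies in [0, t], so
    r_i w_i >= d w_i >= d t; the remaining terms are nonnegative. Since d t <= 0,
    overestimating the number of negative eigenvalues only weakens the bound. *)
Lemma mxinner_ge_neg_eigenvalues D X (t d : R) (l : nat) :
  D \is symmetricmx -> psdmx X -> lemx X (t *: 1%:M) -> 0 <= t ->
  d <= lambda_min D -> d <= 0 -> (nb_neg_eigenvalues D <= l)%N ->
  l%:R * d * t <= mxinner D X.
Proof.
move=> symD psdX leX t0 dle d0; rewrite /nb_neg_eigenvalues.
have [r [w [permD -> w0 wt]]] := spectral_weights symD.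
rewrite (permP permD) count_map -size_filter => lel.
have dr i : d <= r i.
  apply: le_trans dle _; apply: lambda_min_le.
  by rewrite -mem_eigenvalues (perm_mem permD) map_f ?mem_enum.
have dt0 : d * t <= 0 by rewrite mulr_le0_ge0.
apply: (@le_trans _ _ (\sum_(i | r i < 0) d * t)).
  rewrite sumr_const -mulrA -[leRHS]mulr_natl ler_wnM2r// ler_nat.
  by apply: leq_trans lel; rewrite cardE enumT.
rewrite [leRHS](bigID (fun i => r i < 0))/=.
rewrite -[leLHS]addr0 lerD//; last first.
  by apply: sumr_ge0 => i; rewrite -leNgt => ri; rewrite mulr_ge0 ?w0.
apply: ler_sum => i ri0; apply: (@le_trans _ _ (d * w X i)).
  by rewrite ler_wnM2l ?wt.
by rewrite ler_wpM2r ?w0.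
Qed.

Lemma psdmx_outer (v : 'cV[R]_s) : psdmx (v *m v^T).
Proof.
split; first by apply/symmetricmxP; rewrite trmx_mul trmxK.
move=> u; rewrite mulmxA -mulmxA.
have -> : v^T *m u = (u^T *m v)^T by rewrite trmx_mul trmxK.
by rewrite mxE big_ord1 [_^T 0 0]mxE -expr2 sqr_ge0.
Qed.

(** The quadratic form of D at v is the trace product of D with the positive
    semidefinite matrix v v^T, hence a combination of the eigenvalues of D with
    nonnegative weights. *)
Lemma psdmx_lambda_min D : D \is symmetricmx -> 0 <= lambda_min D -> psdmx D.
Proof.
move=> symD le0; split=> // v.
have [r [w [permD innerD w0 _]]] := spectral_weights symD.
have /symmetricmxP DT := symD.
suff -> : (v^T *m D *m v) 0 0 = mxinner D (v *m v^T).
  rewrite innerD; apply: sumr_ge0 => i _.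
  rewrite mulr_ge0 ?w0//; last exact: psdmx_outer.
  apply: le_trans le0 _; apply: lambda_min_le.
  by rewrite -mem_eigenvalues (perm_mem permD) map_f ?mem_enum.
by rewrite /mxinner DT mulmxA mxtrace_mulC mulmxA trace_mx11.
Qed.
End SpectralWeights.

(** * Duality *)

Section Duality.
Variables (R : realType) (s m : nat).
Variables (C : 'M[R]_s) (A : 'I_m -> 'M[R]_s) (b : 'cV[R]_m).

Lemma dual_slack_sym y : C \is symmetricmx ->
  (forall i, A i \is symmetricmx) -> dual_slack C A y \is symmetricmx.
Proof.
move=> /symmetricmxP CT AT; apply/symmetricmxP.
rewrite linearB linear_sum/= CT; congr (_ - _); apply: eq_bigr => i _.
by rewrite linearZ/=; have /symmetricmxP-> := AT i.
Qed.

Lemma primal_objectiveE y X : primal_feasible A b X ->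
  mxinner C X = dual_objective b y + mxinner (dual_slack C A y) X.
Proof.
case=> _ AX; rewrite /mxinner /dual_slack linearB/= mulmxBl linearB/=.
rewrite addrC; suff -> : \tr ((\sum_i y i 0 *: A i)^T *m X) = dual_objective b y
  by rewrite subrK.
rewrite linear_sum/= mulmx_suml linear_sum /dual_objective mxE.
apply: eq_bigr => i _.
by rewrite linearZ/= -scalemxAl linearZ/= [\tr _]AX mxE mulrC.
Qed.

(** The lower bound f is only required at the near-optimal points supplied by
    the hypothesis, not at every feasible point. That hypothesis
    excludes the primal value -oo, for which the gap would be +oo. *)
Lemma ge_primal_value (f : R) :
  (forall eps, 0 < eps -> exists X,
     [/\ primal_feasible A b X, f <= mxinner C X &
      ((mxinner C X)%:E - primal_value C A b <= eps%:E)%E]) ->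
  (f%:E <= primal_value C A b)%E.
Proof.
move=> H; apply/lee_addgt0Pr => e /H[X [_ fX]].
case: primal_value => [p| |]; rewrite ?leey//.
by rewrite -EFinB lee_fin lerBlDl -EFinD lee_fin; exact: le_trans.
Qed.
End Duality.

Theorem corollary6p1 (R : realType) (s m : nat)
  (C : 'M[R]_s) (A : 'I_m -> 'M[R]_s) (b : 'cV[R]_m)
  (xbar : R) (ytilde : 'cV[R]_m) (dminus : R) (l : nat)
  (symC : C \is symmetricmx)
  (symA : forall i, A i \is symmetricmx)
  (xbar_ge0 : 0 <= xbar)
  (primal_hyp :
     (forall X : 'M[R]_s, ~ primal_feasible A b X) \/
     (forall eps : R, 0 < eps ->
        exists X : 'M[R]_s,
          [/\ primal_feasible A b X,
              lemx X (xbar *: 1%:M) &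
              ((mxinner C X)%:E - primal_value C A b <= eps%:E)%E]))
  (dminus_le : dminus <= lambda_min (dual_slack C A ytilde))
  (dminus_le0 : dminus <= 0)
  (neg_le : (nb_neg_eigenvalues (dual_slack C A ytilde) <= l)%N) :
  let f_lower : R := dual_objective b ytilde + l%:R * dminus * xbar in
  (f_lower%:E <= primal_value C A b)%E /\
  (dminus = 0 ->
     [/\ dual_feasible C A ytilde,
         (f_lower%:E <= dual_value C A b)%E,
         f_lower = dual_objective b ytilde &
         (dual_optimal C A b ytilde -> dual_value C A b = f_lower%:E)]).
Proof.
move=> f_lower; have symD := dual_slack_sym ytilde symC symA.
split.
  case: primal_hyp => [infeasible | near_opt].
    by apply: le_ereal_inf_tmp => x [X /= /infeasible].
  apply: ge_primal_value => eps /near_opt[X [feasX leX nearX]].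
  exists X; split=> //; rewrite (primal_objectiveE _ ytilde feasX) lerD2l.
  by apply: mxinner_ge_neg_eigenvalues => //; case: feasX.
move=> d0; have fE : f_lower = dual_objective b ytilde.
  by rewrite /f_lower d0 mulr0 mul0r addr0.
have feasy : dual_feasible C A ytilde.
  by apply: psdmx_lambda_min => //; rewrite -d0.
have lef : (f_lower%:E <= dual_value C A b)%E.
  by rewrite fE; apply: ereal_sup_ubound; exists ytilde.
split=> // -[_ opt]; apply/le_anti/andP; split=> //.
by apply: ge_ereal_sup => _ [z /opt zy <-]; rewrite fE lee_fin.
Qed.
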